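(* Let $a,b,\alpha\in\mathbb{R}$ and $l>0$, and let $$P(x,y)=y\{(x-a)^2+(y-b)^2-l^2\}-l\{(x-a)\sin\alpha-(y-b)\cos\alpha\}(x^2+y^2-1)\in\mathbb{R}[x,y],$$ so that $P(x,y)=0$ is the equation of the edge of the angular Voronoi diagram of the line segment $s_1$ with endpoints $(\pm1,0)$ and the line segment $s_2$ of length $2l$, midpoint $(a,b)$ and direction angle $\alpha$. Then the total degree of $P$ is never equal to one.
   Context: For a line segment $s$ and a point $p$ in the plane, the visual angle $\theta_p(s)\in[0,\pi]$ is the angle formed by the two rays emanating from $p$ through the two endpoints of $s$. For a finite set of line segments $s_1,\dots,s_n$, the angular Voronoi region of $s_i$ is the set of points $p\in\mathbb{R}^2$ with $\theta_p(s_i)<\theta_p(s_j)$ for all $j\neq i$, and the edge of $s_i,s_j$ is the set of $p$ with $\theta_p(s_i)=\theta_p(s_j)<\theta_p(s_k)$ for all $k\neq i,j$. Convention: coordinates are chosen so that $s_1$ has endpoints $(1,0)$ and $(-1,0)$ (any pair of segments can be brought to this form by a similarity), and $s_2$ has length $2l$, midpoint $(a,b)$ and makes angle $\alpha$ with the $x$-axis. The ''equation of the edge'' is then $P(x,y)=0$ with $P$ as in the claim. (The angles $\alpha$ and $\alpha+\pi$ describe the same segment but give different polynomials; the claim concerns $P$ for every real $\alpha$.) *)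

(* Defs.v *)
From mathcomp Require Import all_boot all_order all_algebra.
From mathcomp Require Import reals.
From mathcomp Require trigo.
From mathcomp Require Import mpoly.

Set Implicit Arguments.
Unset Strict Implicit.
Unset Printing Implicit Defensive.

Import Order.TTheory GRing.Theory Num.Theory.
Local Open Scope ring_scope.

(* Let d = (cos alpha, sin alpha) and m = (a, b). Seen from p = (x, y), the   *)
(* oriented angle of the segment from q to r has tangent                      *)
(*   det (q - p, r - p) / <q - p, r - p>.                                     *)
(* For s_1, from (1, 0) to (-1, 0), this is                                   *)
(*   - 2 y / (x^2 + y^2 - 1),                                                 *)
(* and for s_2, from m - l d to m + l d, it is                                *)
(*   - 2 l ((x - a) sin alpha - (y - b) cos alpha)                            *)
(*     / ((x - a)^2 + (y - b)^2 - l^2).                                       *)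
(* Equating the two and clearing denominators gives edge_poly = 0.            *)
Definition edge_poly (R : realType) (a b l alpha : R) : {mpoly R[2]} :=
  let x : {mpoly R[2]} := 'X_0 in
  let y : {mpoly R[2]} := 'X_1 in
  y * ((x - a%:MP) ^+ 2 + (y - b%:MP) ^+ 2 - (l ^+ 2)%:MP)
  - l%:MP * ((x - a%:MP) * (trigo.sin alpha)%:MP
             - (y - b%:MP) * (trigo.cos alpha)%:MP)
    * (x ^+ 2 + y ^+ 2 - 1).

(* msize is 0 on the zero polynomial and one more than the degree otherwise,  *)
(* so the zero polynomial gets total degree 0 here.                           *)
Definition total_degree (n : nat) (R : nzRingType) (p : {mpoly R[n]}) : nat :=
  (msize p).-1.

(* Main.v *)
(** If the degree of [P] is at most one, then [P] is affine along every line
    through the origin. The restrictions to the directions (1,0), (0,1) and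
    (1,1) then force [sin alpha = 0], [l * cos alpha = -1], hence [l = 1] and
    [cos alpha = -1], and finally [a = b = 0]. In that case the two segments
    coincide and [P] is the zero polynomial, which does not have degree one. *)
Require Import Defs.
From mathcomp Require Import all_boot all_order all_algebra.
From mathcomp Require Import reals.
From mathcomp Require trigo.
From mathcomp Require Import mpoly.
From mathcomp Require Import ring lra.

Import Order.TTheory GRing.Theory Num.Theory.
Local Open Scope ring_scope.

(** A monomial of degree [d] scales by [t ^ d] along the line, and [t ^ d - 0 ^ d = t * (1 - 0 ^ d)]
    for [d <= 1], where [0 ^ 0 = 1]. *)
Lemma meval_affine_line (n : nat) (R : comNzRingType) (p : {mpoly R[n]})
    (v : 'I_n -> R) (t : R) :
  (msize p <= 2)%N ->
  p.@[fun i => t * v i] - p.@[fun=> 0] = t * (p.@[v] - p.@[fun=> 0]).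
Proof.
move=> p2.
have hom (s : R) : p.@[fun i => s * v i] =
    \sum_(m <- msupp p) s ^+ mdeg m * (p@_m * \prod_i v i ^+ m i).
  rewrite mevalE; apply: eq_bigr => m _.
  under eq_bigr do rewrite exprMn.
  by rewrite big_split /= prodrXr -mdegE mulrCA.
(* The points [0] and [v] become the scalings of [v] by [0] and [1], so that [hom] expands all the
   values alike. *)
have -> : p.@[fun=> 0] = p.@[fun i => 0 * v i].
  by apply: meval_eq => i; rewrite mul0r.
have -> : p.@[v] = p.@[fun i => 1 * v i].
  by apply: meval_eq => i; rewrite mul1r.
rewrite !hom -!sumrB mulr_sumr big_seq [RHS]big_seq.
apply: eq_bigr => m /msize_mdeg_lt m_lt.
have := leq_trans m_lt p2.
by case: (mdeg m) => [|[|//]] _; ring.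
Qed.

Definition pt (R : realType) (x y : R) : 'I_2 -> R :=
  fun i => if i == 0 then x else y.

Lemma meval_edge_poly (R : realType) (a b l alpha x y : R) :
  (edge_poly a b l alpha).@[pt R x y] =
  y * ((x - a) ^+ 2 + (y - b) ^+ 2 - l ^+ 2)
  - l * ((x - a) * trigo.sin alpha - (y - b) * trigo.cos alpha)
    * (x ^+ 2 + y ^+ 2 - 1).
Proof.
rewrite /edge_poly !(mevalD, mevalN, mevalM, rmorphXn, meval1) /=.
by rewrite !(mevalC, mevalXU, rmorphXn) /=.
Qed.

Lemma edge_poly_affine (R : realType) (a b l alpha t x y : R) :
  (msize (edge_poly a b l alpha) <= 2)%N ->
  let P u v := (edge_poly a b l alpha).@[pt R u v] in
  P (t * x) (t * y) - P 0 0 = t * (P x y - P 0 0).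
Proof.
move=> P2 P; have := meval_affine_line 2 R _ (pt R x y) t P2.
have -> : (edge_poly a b l alpha).@[fun=> 0] = P 0 0.
  by apply: meval_eq => i; rewrite /pt; case: ifP.
by move=> <-; congr (_ - _); apply: meval_eq => i; rewrite /pt; case: ifP.
Qed.

(** Both products in the difference become [y * (x ^ 2 + y ^ 2 - 1)]. *)
Lemma edge_poly_eq0 (R : realType) (alpha : R) :
  trigo.sin alpha = 0 -> trigo.cos alpha = -1 -> edge_poly 0 0 1 alpha = 0.
Proof.
by move=> s0 c1; rewrite /edge_poly s0 c1 expr1n mpolyCN mpolyC0 mpolyC1; ring.
Qed.

Theorem theorem5 (R : realType) (a b l alpha : R) (hl : 0 < l) :
  total_degree (edge_poly a b l alpha) <> 1%N.
Proof.
move=> deg1.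
have P2 : (msize (edge_poly a b l alpha) <= 2)%N.
  by move: deg1; rewrite /total_degree; case: (msize _) => [|[|[|]]].
have aff t x y := edge_poly_affine R a b l alpha t x y P2.
have cs1 := trigo.cos2Dsin2 alpha.
(* On a line through the origin the polynomial is cubic in [t]: [t = -1] makes its quadratic
   coefficient vanish, and [t = 2] then its cubic one. *)
have := aff 2 1 0; have := aff (-1) 1 0; have := aff 2 0 1.
have := aff (-1) 0 1; have := aff (-1) 1 1.
rewrite /= !meval_edge_poly => {aff} d11 d01 d01' d10 d10'.
(* The cubic coefficients along (1,0) and (0,1) are [- l * sin alpha] and [1 + l * cos alpha]. *)
have ls0 : l * trigo.sin alpha = 0 by lra.
have lc1 : l * trigo.cos alpha = -1 by lra.
have l1 : l = 1.
  apply/eqP; rewrite -(@pexpr_eq1 _ l 2) ?ltW //; apply/eqP.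
  transitivity ((l * trigo.cos alpha) ^+ 2 + (l * trigo.sin alpha) ^+ 2).
    by rewrite !exprMn -mulrDr cs1 mulr1.
  by rewrite ls0 lc1; ring.
subst l; rewrite !mul1r in ls0 lc1.
rewrite ls0 lc1 in d11 d01 d10.
(* The quadratic coefficients along (1,0) and (1,1) are now [b] and [-2 * a]. *)
have b0 : b = 0 by lra.
have a0 : a = 0 by subst b; lra.
by move: deg1; rewrite a0 b0 edge_poly_eq0 // /total_degree msize0.
Qed.
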